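(* Let $a=(a_i)_{i\in\mathbb Z}$ be any sequence of complex numbers. If $\mu,\lambda$ are Young diagrams with $\mu\not\subseteq\lambda$, then $s_{\mu;a}(x(\lambda);y(\lambda))=0$.
   Context: $\Lambda$ is the algebra of symmetric functions over $\mathbb C$ with complete homogeneous $h_k$, elementary $e_k$, power sums $\mathbf p_k$. For a sequence $a$ define $h_{k;a}=\sum_{i=1}^k(-1)^{k-i}e_{k-i}(a_1,\dots,a_{k-1})h_i$ ($k\ge1$), $h_{0;a}=1$, $h_{k;a}=0$ ($k<0$); $(\tau^ra)_i=a_{i+r}$; $s_{\mu;a}=\det[h_{\mu_i-i+j;\,\tau^{1-j}a}]_{i,j=1}^N$ for any $N\ge\ell(\mu)$. Dual sequence: $\widehat a_i=-a_{1-i}$. Each $f\in\Lambda$ is evaluated at $(x;y)\in\mathbb C^d\times\mathbb C^d$ via $\mathbf p_k\mapsto\sum_ix_i^k+(-1)^{k-1}\sum_jy_j^k$. For a nonempty diagram $\lambda=(p_1,\dots,p_d\mid q_1,\dots,q_d)$ in Frobenius notation ($p_i=\lambda_i-i$, $q_i=\lambda'_i-i$, $d$ the number of diagonal boxes), set $(x(\lambda);y(\lambda))=(a_{p_1+1},\dots,a_{p_d+1};\widehat a_{q_1+1},\dots,\widehat a_{q_d+1})\in\mathbb C^d\times\mathbb C^d$; and $(x(\varnothing);y(\varnothing))=(0;0)$. *)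

(* Defs.v *)
From HB Require Import structures.
From mathcomp Require Import all_boot all_order all_algebra.
From mathcomp Require Import Rstruct.
From mathcomp Require Import complex.
Set Implicit Arguments. Unset Strict Implicit. Unset Printing Implicit Defensive.
Import Order.TTheory GRing.Theory Num.Theory.
Local Open Scope ring_scope.

Definition CC : Type := (Rdefinitions.R)[i].
HB.instance Definition _ := GRing.Field.on CC.

(* A Young diagram is a weakly decreasing finite sequence of positive
   integers (lambda_1, lambda_2, ...); lambda_i = nth 0 lambda (i-1). *)
Definition is_diagram (l : seq nat) : bool :=
  sorted geq l && all (fun k => 0 < k)%N l.

Definition diag_sub (mu lam : seq nat) : Prop :=
  forall i : nat, (nth 0 mu i <= nth 0 lam i)%N.

(* conjugate part lambda'_i (1-indexed i) *)
Definition conj_part (lam : seq nat) (i : nat) : nat :=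
  count (fun k => i <= k)%N lam.

Definition ndiag (lam : seq nat) : nat :=
  count (fun i => i.+1 <= nth 0 lam i)%N (iota 0 (size lam)).

(* Frobenius coordinates (1-indexed i): p_i = lambda_i - i, q_i = lambda'_i - i *)
Definition frob_p (lam : seq nat) (i : nat) : int := (nth 0 lam i.-1)%:Z - i%:Z.
Definition frob_q (lam : seq nat) (i : nat) : int := (conj_part lam i)%:Z - i%:Z.

Definition shift (r : int) (a : int -> CC) : int -> CC := fun i => a (i + r).
Definition dual_seq (a : int -> CC) : int -> CC := fun i => - a (1 - i).

Definition x_of (a : int -> CC) (lam : seq nat) : seq CC :=
  if lam is [::] then [:: 0]
  else [seq a (frob_p lam i + 1) | i <- iota 1 (ndiag lam)].
Definition y_of (a : int -> CC) (lam : seq nat) : seq CC :=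
  if lam is [::] then [:: 0]
  else [seq dual_seq a (frob_q lam i + 1) | i <- iota 1 (ndiag lam)].

(* image of the power sum p_k (k >= 1) *)
Definition pev (xs ys : seq CC) (k : nat) : CC :=
  \sum_(x <- xs) x ^+ k + (-1) ^+ k.-1 * \sum_(y <- ys) y ^+ k.

(* images of h_0, ..., h_n, computed from the images of the power sums by
   Newton's identities  k h_k = sum_{i=1}^k p_i h_{k-i}  (valid in Lambda). *)
Fixpoint hev_seq (xs ys : seq CC) (n : nat) : seq CC :=
  match n with
  | 0 => [:: 1]
  | n'.+1 => let s := hev_seq xs ys n' in
      rcons s ((n'.+1)%:R^-1 *
               \sum_(i < n'.+1) pev xs ys i.+1 * nth 0 s (n' - i))
  end.

Definition hev (xs ys : seq CC) (k : nat) : CC := nth 0 (hev_seq xs ys k) k.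

Definition esym (s : seq CC) (m : nat) : CC :=
  \sum_(I : {set 'I_(size s)} | #|I| == m) \prod_(i in I) nth 0 s i.

Definition hka_ev (xs ys : seq CC) (k : int) (a : int -> CC) : CC :=
  match k with
  | Posz 0 => 1
  | Posz k'.+1 =>
      \sum_(1 <= i < k'.+2)
        (-1) ^+ (k'.+1 - i) * esym [seq a j%:Z | j <- iota 1 k'] (k'.+1 - i)
          * hev xs ys i
  | Negz _ => 0
  end.

(* image at (x;y) of s_{mu;a} = det[h_{mu_i - i + j; tau^{1-j} a}]_{i,j=1}^N,
   with N = l(mu) (the evaluation is a ring morphism, so it commutes with det). *)
Definition sma_ev (mu : seq nat) (a : int -> CC) (xs ys : seq CC) : CC :=
  \det (\matrix_(i < size mu, j < size mu)
          hka_ev xs ys ((nth 0 mu i)%:Z - (i.+1)%:Z + (j.+1)%:Z)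
                 (shift (1 - (j.+1)%:Z) a)).

(* Main.v *)
Require Import Defs.
From mathcomp Require Import all_boot all_order all_algebra.
From mathcomp Require Import Rstruct complex.
From mathcomp Require Import zify ring.
Set Implicit Arguments. Unset Strict Implicit. Unset Printing Implicit Defensive.
Import Order.TTheory GRing.Theory Num.Theory.
Local Open Scope ring_scope.

(* With rows indexed from 0 and [N >= l(lam), l(mu)], the evaluation at
   [(x(lam); y(lam))] turns the generating series [\sum_k h_k u^-k] into
   [A / D], where [A = \prod_(l < N) (u - a_{-l})] and
   [D = \prod_(l < N) (u - a_{lam_l - l})]. Entry [(i, j)] of the determinant is
   then the coefficient of [u^-1] in [R_i B_j / D], where [R_i] is the product of
   the [u - a_m] for [1 - N <= m <= mu_i - i - 1] and [B_j] depends only on [j].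
   If [lam_r < mu_r], the polynomials [R_0, ..., R_r] are all divisible by the
   [N - r] factors of [D] with [l >= r], so they are linearly dependent modulo
   [D], and the rows [0, ..., r] are linearly dependent. *)

(** * Newton's identities and multiplication of series by linear factors *)

Section NewtonSequences.
Variable F : fieldType.
Implicit Types (p : nat -> F) (h : int -> F) (w : F) (ws : seq F).

(** These are Newton's identities between power sums [p] and complete homogeneous values [h].
    Integer indices with zeros on the negative side let shifts of [h] be written without case
    distinctions. *)
Definition newton p h : Prop :=
  [/\ forall n, h (Negz n) = 0, h 0 = 1 &
      forall k : nat, k%:R * h k = \sum_(i < k) p i.+1 * h (k%:Z - i.+1%:Z)].

(* On generating series in [t], this is multiplication by [1 - w t]. *)
Definition mulw w h : int -> F := fun k => h k - w * h (k - 1).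

(** On generating series [newton] says [t H' = P H]. The factor [1 - w t] adds [- w t / (1 - w t)],
    that is [- \sum_(k >= 1) w^k t^k], to the logarithmic derivative [P]. *)
Lemma newton_mulw p h w :
  newton p h -> newton (fun k => p k - w ^+ k) (mulw w h).
Proof.
move=> [hN h0 hk]; split => [n||k].
- have ->: mulw w h (Negz n) = h (Negz n) - w * h (Negz n.+1).
    by rewrite /mulw; congr (_ - _ * h _); lia.
  by rewrite !hN mulr0 subr0.
- have ->: mulw w h 0 = h 0 - w * h (Negz 0) by [].
  by rewrite hN mulr0 subr0.
rewrite /mulw mulrBr hk mulrCA.
have -> : k%:R * h (k%:Z - 1) =
    \sum_(i < k) p i.+1 * h (k%:Z - i.+1%:Z - 1) + h (k%:Z - 1).
  case: k => [|k]; first by rewrite big_ord0 mul0r (_ : _ - 1 = Negz 0) // hN addr0.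
  rewrite big_ord_recr (_ : _ - _ - 1 = Negz 0) ?hN ?mulr0 ?addr0; last first.
    by rewrite /=; lia.
  rewrite (_ : k.+1%:Z - 1 = k) ?mulrSr ?mulrDl ?mul1r ?hk; last by lia.
  rewrite /= addr0; congr (_ + _); apply: eq_bigr => i _; congr (_ * h _).
  by rewrite /=; lia.
(* Coefficientwise form of [(\sum_(k >= 1) w^k t^k) (1 - w t) = w t], multiplied by [H]. *)
have tele : \sum_(i < k)
    w ^+ i.+1 * (h (k%:Z - i.+1%:Z) - w * h (k%:Z - i.+1%:Z - 1))
    = w * h (k%:Z - 1).
  pose f i := - (w ^+ i.+1 * h (k%:Z - i.+1%:Z)).
  have := telescope_sumr f (leq0n k).
  rewrite big_mkord /f (_ : k%:Z - k.+1%:Z = Negz 0) ?hN; last by lia.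
  rewrite mulr0 expr1 oppr0 sub0r opprK.
  move=> <-; apply: eq_bigr => i _.
  by rewrite (_ : k%:Z - i.+2%:Z = k%:Z - i.+1%:Z - 1) ?[w ^+ i.+2]exprS; [ring | lia].
under [RHS]eq_bigr do rewrite mulrBl.
rewrite sumrB tele mulrDr opprD addrA; congr (_ - _).
under [RHS]eq_bigr do rewrite mulrBr mulrCA.
by rewrite sumrB -mulr_sumr.
Qed.

Lemma newton_foldr_mulw p h ws : newton p h ->
  newton (fun k => p k - \sum_(w <- ws) w ^+ k) (foldr mulw h ws).
Proof.
move=> nh; elim: ws => [|w ws IH] /=.
  by case: nh => hN h0 hk; split=> // k; under eq_bigr do rewrite big_nil subr0.
have [gN g0 gk] := newton_mulw w IH; split=> // k.
by rewrite gk; apply: eq_bigr => i _; rewrite big_cons opprD addrA addrAC.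
Qed.

(** In characteristic zero one may divide by [k], so the identities determine [h k] recursively from
    the power sums. *)
Lemma newton_uniq p q h g : [pchar F] =i pred0 ->
  newton p h -> newton q g -> (forall k, p k.+1 = q k.+1) -> h =1 g.
Proof.
move=> ch0 [hN h0 hk] [gN g0 gk] epq [n|n]; last by rewrite hN gN.
elim/ltn_ind: n => -[|n] IH; first by rewrite h0 g0.
have n0 : n.+1%:R != 0 :> F by rewrite (pcharf0P F).1.
apply: (mulfI n0); rewrite hk gk; apply: eq_bigr => i _.
rewrite epq (_ : n.+1%:Z - i.+1%:Z = (n - i)%N); last by have := ltn_ord i; lia.
by rewrite IH // ltnS leq_subr.
Qed.

Lemma newton_delta : newton (fun=> 0) (fun k => (k == 0)%:R).
Proof.
split=> // k; rewrite big1 => [|i _]; last by rewrite mul0r.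
by case: k => [|k]; rewrite ?mul0r ?mulr0.
Qed.

End NewtonSequences.

(** * Coefficients of a polynomial times a series in [u^-1] *)

Section CoefficientFunctional.
Variable F : fieldType.
Implicit Types (h : int -> F) (s : int) (f g : {poly F}).

(* The coefficient of [u^-s] in [f(u) * \sum_k h_k u^-k]. *)
Definition coefsum h s f : F := \sum_(i < size f) f`_i * h (i%:Z + s).

Lemma coefsum_widen h s f n : (size f <= n)%N ->
  coefsum h s f = \sum_(i < n) f`_i * h (i%:Z + s).
Proof.
move=> le_n; rewrite /coefsum (big_ord_widen n (fun i => f`_i * h (i%:Z + s)) le_n).
rewrite big_mkcond; apply: eq_bigr => i _.
by case: ltnP => // le_i; rewrite nth_default ?mul0r.
Qed.

Lemma coefsumD h s f g : coefsum h s (f + g) = coefsum h s f + coefsum h s g.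
Proof.
pose n := maxn (size f) (size g).
rewrite !(@coefsum_widen h s _ n) ?leq_maxl ?leq_maxr ?size_polyD //.
by rewrite -big_split; apply: eq_bigr => i _; rewrite coefD mulrDl.
Qed.

Lemma coefsumZ h s c f : coefsum h s (c *: f) = c * coefsum h s f.
Proof.
rewrite (@coefsum_widen h s _ (size f)) ?size_scale_leq // mulr_sumr.
by apply: eq_bigr => i _; rewrite coefZ mulrA.
Qed.

Lemma coefsum_sum h s (I : finType) (v : I -> F) (R : I -> {poly F}) :
  coefsum h s (\sum_i v i *: R i) = \sum_i v i * coefsum h s (R i).
Proof.
rewrite (big_morph _ (coefsumD h s) (_ : _ = 0)).
  by apply: eq_bigr => i _; rewrite coefsumZ.
by rewrite /coefsum size_poly0 big_ord0.
Qed.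

Lemma eq_coefsum h1 h2 s f : h1 =1 h2 -> coefsum h1 s f = coefsum h2 s f.
Proof. by move=> e; apply: eq_bigr => i _; rewrite e. Qed.

(** Write [u - w = u (1 - w u^-1)]: the factor [u] shifts [s] by one and the other factor acts on
    [h] as [mulw w]. *)
Lemma coefsum_mulXsubC h s w f :
  coefsum h s (('X - w%:P) * f) = coefsum (mulw w h) (s + 1) f.
Proof.
rewrite mulrBl coefsumD mulrC -mulNr -polyCN mul_polyC coefsumZ.
rewrite (@coefsum_widen h s _ (size f).+1).
  rewrite big_ord_recl coefMX mul0r add0r mulr_sumr -big_split.
  apply: eq_bigr => i _; rewrite coefMX /mulw /=.
  rewrite (_ : (lift ord0 i)%:Z + s = i%:Z + (s + 1)); last by rewrite /= /bump; lia.
  by rewrite (_ : i%:Z + (s + 1) - 1 = i%:Z + s); [ring | lia].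
by rewrite (leq_trans (size_polyMleq _ _)) // size_polyX addn2.
Qed.

Lemma coefsum_mul_prodXsubC h s ws f :
  coefsum h s (\prod_(w <- ws) ('X - w%:P) * f) =
  coefsum (foldr (@mulw F) h ws) (s + (size ws)%:Z) f.
Proof.
elim: ws f => [|w ws IH] f /=; first by rewrite big_nil mul1r addr0.
rewrite big_cons -mulrA mulrCA IH coefsum_mulXsubC.
by rewrite (_ : s + (size ws)%:Z + 1 = s + (size ws).+1%:Z) //; lia.
Qed.

End CoefficientFunctional.

(** * Linear dependence modulo a product, and divisibility *)

Section Polynomials.
Variable F : fieldType.

(* The coefficient matrix of the quotients modulo [E] is completed by identity
   rows, which leaves its column [r] equal to zero. *)
Lemma dvdp_lin_dep n (r : 'I_n) (R : 'I_n -> {poly F}) (G E : {poly F}) :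
  E != 0 -> (size E <= r.+1)%N ->
  (forall i : 'I_n, (i <= r)%N -> G %| R i) ->
  exists2 v : 'rV[F]_n, v != 0 & G * E %| \sum_i v 0 i *: R i.
Proof.
move=> E0 szE GR; pose T i := (R i %/ G) %% E.
pose K := \matrix_(i < n, j < n)
  if (i <= r)%N then (T i)`_j else (i == j)%:R.
have szT i : (size (T i) <= r)%N.
  by rewrite -ltnS (leq_trans _ szE) // ltn_modp.
have /det0P[v v0 vK] : \det K == 0.
  rewrite (expand_det_col _ r) big1 // => i _; rewrite mxE.
  case: leqP => ir; first by rewrite nth_default ?mul0r.
  by rewrite -val_eqE /= gtn_eqF ?mul0r.
have vK0 j : \sum_i v 0 i * K i j = 0.
  by move/matrixP/(_ 0 j): vK; rewrite !mxE.
(* In a column [j > r] the rows up to [r] vanish and the others form an identity. Hence [v] lives on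
   the indices up to [r], where [G] divides [R i]. *)
have vr (j : 'I_n) : (r < j)%N -> v 0 j = 0.
  move=> rj; rewrite -[RHS](vK0 j) (bigD1 j) //= mxE leqNgt rj /= eqxx mulr1.
  rewrite big1 ?addr0 // => i ij; rewrite mxE.
  case: leqP => ir; last by rewrite (negPf ij) mulr0.
  by rewrite nth_default ?mulr0 // (leq_trans (szT i)) // ltnW.
exists v => //.
have -> : \sum_i v 0 i *: R i = G * \sum_i v 0 i *: (R i %/ G).
  rewrite mulr_sumr; apply: eq_bigr => i _; case: (leqP i r) => ir.
    by rewrite -scalerAr [G * _]mulrC divpK // GR.
  by rewrite vr // !scale0r mulr0.
apply: dvdp_mul => //; apply/modp_eq0P.
have mod_sum : (\sum_i v 0 i *: (R i %/ G)) %% E = \sum_i v 0 i *: T i.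
  rewrite (big_morph (fun p => p %% E) (@modpD _ E) (mod0p E)).
  by apply: eq_bigr => i _; rewrite modpZl.
rewrite mod_sum; apply/polyP => k; rewrite coef0 coef_sum.
have [rk|kr] := leqP r k.
  by rewrite big1 // => i _; rewrite coefZ nth_default ?mulr0 // (leq_trans (szT i)).
rewrite -[RHS](vK0 (Ordinal (ltn_trans kr (ltn_ord r)))).
apply: eq_bigr => i _; rewrite coefZ mxE; case: leqP => //= ir.
by rewrite vr // !mul0r.
Qed.

Lemma dvdp_prod_subset (I : eqType) (s1 s2 : seq I) (f : I -> {poly F}) :
  uniq s1 -> uniq s2 -> {subset s1 <= s2} ->
  \prod_(i <- s1) f i %| \prod_(i <- s2) f i.
Proof.
move=> u1 u2 s12; rewrite [X in _ %| X](bigID (mem s1)) /=; apply: dvdp_mulr.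
rewrite -[X in _ %| X]big_filter.
rewrite (@perm_big _ _ _ _ s1 [seq i <- s2 | i \in s1]) //.
apply: uniq_perm; rewrite ?filter_uniq // => i; rewrite mem_filter.
by case: (boolP (i \in s1)) => //= /s12.
Qed.

End Polynomials.

(** * Vieta's formula and the evaluated complete homogeneous functions *)

Lemma coef_prodXsubC (s : seq CC) k : (k <= size s)%N ->
  (\prod_(x <- s) ('X - x%:P))`_k = (-1) ^+ (size s - k) * Defs.esym s (size s - k).
Proof.
move=> ks; rewrite (big_nth 0) big_mkord.
under eq_bigr do rewrite addrC.
(* In the expansion, [J] is the set of factors that contribute their constant term. *)
rewrite bigA_distr /= coef_sum /Defs.esym mulr_sumr [RHS]big_mkcond.
apply: eq_bigr => J _.
have -> : \prod_i (if i \in J then - (s`_i)%:P else 'X) =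
    (\prod_(i in J) - s`_i) *: 'X^(size s - #|J|) :> {poly CC}.
  rewrite (bigID (mem J)) /= (eq_bigr (fun i : 'I__ => (- s`_i)%:P)).
    rewrite [X in _ * X](eq_bigr (fun=> 'X)); last by move=> i /negPf ->.
    rewrite -rmorph_prod mul_polyC prodr_const; congr (_ *: 'X^_).
    by rewrite -[X in (X - _)%N]card_ord -(cardC (mem J)) addKn; apply: eq_card.
  by move=> i ->; rewrite polyCN.
rewrite coefZ coefXn prodrN.
have cJ : (#|J| <= size s)%N by rewrite -[X in (_ <= X)%N]card_ord max_card.
have -> : (k == size s - #|J|)%N = (#|J| == size s - k)%N by lia.
by case: eqP => [->|_]; rewrite ?mulr1 ?mulr0.
Qed.

Lemma pchar_CC : [pchar CC] =i pred0.
Proof. exact: (@pchar_num (complex Rdefinitions.R)). Qed.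

Lemma pev_nil (s : seq CC) k : pev s [::] k = \sum_(x <- s) x ^+ k.
Proof. by rewrite /pev big_nil mulr0 addr0. Qed.

Section Evaluation.
Variables xs ys : seq CC.

Definition hev_int (k : int) : CC := if k is Posz n then hev xs ys n else 0.

Lemma size_hev_seq n : size (hev_seq xs ys n) = n.+1.
Proof. by elim: n => //= n IH; rewrite size_rcons IH. Qed.

Lemma nth_hev_seq n k : (k <= n)%N -> nth 0 (hev_seq xs ys n) k = hev xs ys k.
Proof.
elim: n => [|n IH]; first by rewrite leqn0 => /eqP ->.
rewrite leq_eqVlt => /orP[/eqP -> //|kn].
by rewrite /= nth_rcons size_hev_seq kn IH.
Qed.

Lemma newton_hev : newton (pev xs ys) hev_int.
Proof.
split=> // -[|k]; first by rewrite big_ord0 mul0r.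
have k0 : k.+1%:R != 0 :> CC by rewrite (pcharf0P CC).1 //; exact: pchar_CC.
rewrite {1}/hev_int /hev /= nth_rcons size_hev_seq ltnn eqxx mulVKf //.
apply: eq_bigr => i _; rewrite nth_hev_seq ?leq_subr //; congr (_ * _).
by rewrite (_ : k.+1%:Z - i.+1%:Z = (k - i)%N) //; have := ltn_ord i; lia.
Qed.

(** By Vieta the signed elementary functions are the coefficients of the product; pairing the
    coefficient of [u^i] with [h_(i+1)] extracts [u^-1]. *)
Lemma hka_ev_coefsum k (a : int -> CC) :
  hka_ev xs ys k.+1 a =
  coefsum hev_int 1 (\prod_(x <- [seq a j%:Z | j <- iota 1 k]) ('X - x%:P)).
Proof.
rewrite /hka_ev big_add1 /= big_mkord /coefsum size_prod_XsubC size_map size_iota.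
apply: eq_bigr => i _; rewrite coef_prodXsubC size_map size_iota; last first.
  by have := ltn_ord i.
by rewrite subSS (_ : i%:Z + 1 = i.+1) //; lia.
Qed.

End Evaluation.

(** * Frobenius coordinates and power sums of a diagram *)

Section Diagrams.
Variable lam : seq nat.
Hypothesis lamP : is_diagram lam.
Local Notation part := (nth 0%N lam).

Lemma part_anti i j : (i <= j)%N -> (part j <= part i)%N.
Proof.
move=> ij; have [js|js] := ltnP j (size lam); last by rewrite (nth_default _ js).
have /andP[so _] := lamP.
apply: (sorted_leq_nth (leT := geq)) => //; rewrite ?inE //.
- by move=> x y z /= xy yz; exact: leq_trans yz xy.
- exact: leqnn.
- exact: leq_ltn_trans js.
Qed.

(** Such a [P] holds exactly on an initial segment, whose length is the count. This turns [ndiag]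
    and [conj_part] into comparisons of parts. *)
Lemma ltn_count_iota (P : pred nat) n :
  (forall i j, (i <= j)%N -> P j -> P i) -> (forall i, P i -> (i < n)%N) ->
  forall i, (i < count P (iota 0 n))%N = P i.
Proof.
move=> Pd Pn i; have [ni|i_n] := leqP n i.
  rewrite ltnNge (leq_trans (count_size _ _)) ?size_iota //=.
  by case: (boolP (P i)) => // /Pn; rewrite ltnNge ni.
elim: n i_n {Pn} => // n IH; rewrite ltnS -(addn1 n) iotaD count_cat /= add0n addn0.
case: (boolP (P n)) => Pn.
  have /eqP -> : count P (iota 0 n) == n.
    rewrite -[X in _ == X](size_iota 0 n) -all_count; apply/allP => j.
    by rewrite mem_iota => /andP[_ /ltnW jn]; exact: Pd Pn.
  by rewrite addn1 ltnS => i_n; rewrite i_n (Pd _ _ i_n).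
rewrite addn0 leq_eqVlt => /orP[/eqP ->|//].
by rewrite (negPf Pn) ltnNge (leq_trans (count_size _ _)) ?size_iota.
Qed.

Lemma part_gt0_size i : (0 < part i)%N -> (i < size lam)%N.
Proof. by case: (ltnP i (size lam)) => // si; rewrite nth_default. Qed.

Lemma ltn_ndiag i : (i < ndiag lam)%N = (i < part i)%N.
Proof.
apply: (@ltn_count_iota (fun j => j < part j)%N) => [j k jk kp|j jp].
  exact: leq_ltn_trans jk (leq_trans kp (part_anti jk)).
by apply: part_gt0_size; apply: leq_ltn_trans jp.
Qed.

Lemma ltn_conj_part i j : (i < conj_part lam j.+1)%N = (j < part i)%N.
Proof.
rewrite /conj_part -[in count _ lam](mkseq_nth 0%N lam) count_map.
apply: (@ltn_count_iota (fun i => j < part i)%N) => [k l kl jp|k jp].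
  exact: leq_trans jp (part_anti kl).
by apply: part_gt0_size; apply: leq_ltn_trans jp.
Qed.

(* The two lists are disjoint because [i < lam'_j] if and only if [j < lam_i]. *)
Lemma perm_frobenius N : (size lam <= N)%N ->
  perm_eq ([seq (conj_part lam j.+1 - j.+1)%N | j <- iota 0 (ndiag lam)] ++
           [seq (i - part i)%N | i <- iota (ndiag lam) (N - ndiag lam)])
          (iota 0 N).
Proof.
move=> szN; set d := ndiag lam; set s := _ ++ _.
have dN : (d <= N)%N.
  by rewrite (leq_trans (count_size _ _)) // size_iota.
have cj j : (j < d)%N -> (j < conj_part lam j.+1)%N.
  by rewrite ltn_conj_part -ltn_ndiag.
have pi i : (d <= i)%N -> (part i <= i)%N by rewrite leqNgt ltn_ndiag -leqNgt.
have cN j : (conj_part lam j.+1 <= N)%N := leq_trans (count_size _ _) szN.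
have sub (v : nat) : v \in s -> v \in iota 0 N.
  rewrite mem_cat mem_iota add0n => /orP[] /mapP[ i ];
    rewrite mem_iota => /andP[i1 i2] ->; rewrite leq0n /=.
    by have := cj i i2; have := cN i; lia.
  by lia.
have us : uniq s.
  rewrite cat_uniq; apply/and3P; split.
  - rewrite map_inj_in_uniq ?iota_uniq // => i j.
    rewrite !mem_iota => /andP[_ di] /andP[_ dj].
    have anti k l : (k <= l)%N -> (conj_part lam l.+1 <= conj_part lam k.+1)%N.
      by move=> kl; apply: sub_count => x; exact: leq_ltn_trans.
    have ci := cj _ di; have cj' := cj _ dj.
    by have [ij|/ltnW ij] := leqP i j; have := anti _ _ ij; move=> /=; lia.
  - apply/hasPn => v /mapP[ i ]; rewrite mem_iota => /andP[di _] ->.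
    apply/mapP => -[j]; rewrite mem_iota => /andP[_ dj] e.
    have := pi _ di; have := cj _ dj; move: e.
    by case: (ltnP j (part i)) (ltn_conj_part i j) => ? /idP; lia.
  - rewrite map_inj_in_uniq ?iota_uniq // => i j.
    rewrite !mem_iota => /andP[di _] /andP[dj _].
    have pi' := pi _ di; have pj := pi _ dj.
    by have [ij|/ltnW ij] := leqP i j; have := part_anti ij; move=> /=; lia.
apply: uniq_perm => //; first exact: iota_uniq.
(* Both lists have length [N], so the inclusion of one duplicate-free list in the other gives the
   same elements. *)
have [] // := uniq_min_size us sub.
by rewrite size_cat !size_map !size_iota subnKC.
Qed.

(** By [perm_frobenius], the terms [a (- i)] split into the [y] family and the terms of the rows
    [i >= ndiag lam]; the latter cancel in the difference. *)
Lemma pev_frobenius (a : int -> CC) N k : (size lam <= N)%N ->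
  pev (x_of a lam) (y_of a lam) k.+1 =
  \sum_(i <- iota 0 N) a ((part i)%:Z - i%:Z) ^+ k.+1
  - \sum_(i <- iota 0 N) a (- i%:Z) ^+ k.+1.
Proof.
move=> szN; have dN : (ndiag lam <= N)%N.
  by rewrite (leq_trans (count_size _ _)) // size_iota.
have pevE : pev (x_of a lam) (y_of a lam) k.+1 =
    \sum_(i <- iota 0 (ndiag lam)) a ((part i)%:Z - i%:Z) ^+ k.+1
    - \sum_(j <- iota 0 (ndiag lam)) a (- (conj_part lam j.+1 - j.+1)%N%:Z) ^+ k.+1.
  case El : lam => [|l0 l]; last rewrite -El.
    (* The empty diagram is evaluated at [(0; 0)], where power sums of positive degree vanish. *)
    by rewrite /pev /= !big_seq1 expr0n /= mulr0 addr0 !big_nil subr0.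
  have -> : x_of a lam = [seq a (frob_p lam i + 1) | i <- iota 1 (ndiag lam)].
    by rewrite El.
  have -> : y_of a lam =
      [seq dual_seq a (frob_q lam i + 1) | i <- iota 1 (ndiag lam)].
    by rewrite El.
  rewrite /pev !big_map (iotaDl 1 0) !big_map; congr (_ + _).
    apply: eq_bigr => i _; rewrite /frob_p add1n -[lam`__]/(part i).
    by congr (a _ ^+ _); lia.
  rewrite mulr_sumr -sumrN big_seq [RHS]big_seq; apply: eq_bigr => j.
  rewrite mem_iota add0n ltn_ndiag -ltn_conj_part /= => jc.
  (* The sign [(-1)^k] of the [y] part and the sign in [dual_seq] combine to a single minus. *)
  rewrite /dual_seq /frob_q add1n [(- a _) ^+ _]exprNn [(-1) ^+ k.+1]exprS /=.
  rewrite mulN1r mulNr mulrN mulrA -expr2 sqrr_sign mul1r.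
  by congr (- (a _ ^+ _)); lia.
have eN : iota 0 N = iota 0 (ndiag lam) ++ iota (ndiag lam) (N - ndiag lam).
  by rewrite -iotaD subnKC.
have sN : \sum_(i <- iota 0 N) a (- i%:Z) ^+ k.+1 = _ :=
  esym (perm_big _ (perm_frobenius szN)).
rewrite pevE sN eN !big_cat !big_map /=.
have -> : \sum_(i <- iota (ndiag lam) (N - ndiag lam))
    a (- (i - part i)%N%:Z) ^+ k.+1
  = \sum_(i <- iota (ndiag lam) (N - ndiag lam)) a ((part i)%:Z - i%:Z) ^+ k.+1.
  rewrite big_seq [RHS]big_seq; apply: eq_bigr => i.
  rewrite mem_iota leqNgt ltn_ndiag -leqNgt => /andP[di _].
  by congr (a _ ^+ _); lia.
by rewrite opprD addrACA subrr addr0.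
Qed.

End Diagrams.

(** * Products of consecutive factors [u - a_m] *)

Section Factorial.
Variable a : int -> CC.

(** The polynomials [A], [R_i] and [B_j] all have this form, with [b] equal to [1 - N], [1 - N] and
    [1 - j]. *)
Definition facpoly (b : int) (n : nat) : {poly CC} :=
  \prod_(t <- iota 0 n) ('X - (a (b + t%:Z))%:P).

Lemma facpolyD b m n : facpoly b (m + n) = facpoly b m * facpoly (b + m%:Z) n.
Proof.
rewrite /facpoly iotaD big_cat (addnC 0%N) iotaDl big_map /=.
by congr (_ * _); apply: eq_bigr => t _; rewrite PoszD addrA.
Qed.

Lemma size_facpoly b n : size (facpoly b n) = n.+1.
Proof. by rewrite size_prod_XsubC size_iota. Qed.

Lemma monic_facpoly b n : facpoly b n \is monic.
Proof. exact: monic_prod_XsubC. Qed.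

Lemma hka_ev_facpoly xs ys k j :
  hka_ev xs ys k.+1 (shift (1 - j.+1%:Z) a) =
  coefsum (hev_int xs ys) 1 (facpoly (1 - j%:Z) k).
Proof.
rewrite hka_ev_coefsum big_map (iotaDl 1 0) big_map; congr coefsum.
by apply: eq_bigr => t _; rewrite /shift; congr ('X - (a _)%:P); lia.
Qed.

End Factorial.

(** * Matrix entries as residues, and the vanishing determinant *)

Section Vanishing.
Variables (a : int -> CC) (lam : seq nat) (N : nat).
Hypotheses (lamP : is_diagram lam) (szN : (size lam <= N)%N).
Local Notation part := (nth 0%N lam).

Let zs := [seq a ((part l)%:Z - l%:Z) | l <- iota 0 N].
Let ws := [seq a (1 - N%:Z + t%:Z) | t <- iota 0 N].
Let D := \prod_(z <- zs) ('X - z%:P).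
Let h := hev_int (x_of a lam) (y_of a lam).

(* [residue f] is the coefficient of [u^-1] in [f / D] expanded at infinity.
   Since the generating series of the [h_k] is [facpoly a (1 - N) N / D], every
   matrix entry of [s_{mu;a}] is such a residue. *)
Let residue := coefsum (hev_int zs [::]) (1 - N%:Z).

(** Multiplying by [D] cancels all power sums of [zs], so the series becomes [1], and a polynomial
    has no [u^-1] term. *)
Lemma residue_mulD f : residue (D * f) = 0.
Proof.
rewrite /residue coefsum_mul_prodXsubC.
have e := newton_uniq pchar_CC
  (newton_foldr_mulw zs (newton_hev zs [::])) (newton_delta CC).
rewrite (eq_coefsum _ _ (e _)) => [|k]; last by rewrite pev_nil subrr.
rewrite size_map size_iota subrK /coefsum big1 // => i _.
by rewrite (_ : (i%:Z + 1 == 0) = false) ?mulr0 //; lia.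
Qed.

(** By [pev_frobenius] the evaluated power sums are those of [zs] minus those of [ws], so
    [newton_uniq] identifies the two series. *)
Lemma residue_mul_facpoly f :
  residue (facpoly a (1 - N%:Z) N * f) = coefsum h 1 f.
Proof.
have -> : facpoly a (1 - N%:Z) N = \prod_(w <- ws) ('X - w%:P) by rewrite big_map.
rewrite /residue coefsum_mul_prodXsubC size_map size_iota subrK.
apply: eq_coefsum; apply: newton_uniq pchar_CC
  (newton_foldr_mulw ws (newton_hev zs [::])) (newton_hev _ _) _ => k.
rewrite (pev_frobenius lamP _ _ szN) pev_nil !big_map; congr (_ - _).
have -> : iota 0 N = index_iota 0 N by rewrite /index_iota subn0.
rewrite !big_mkord [LHS](reindex_inj rev_ord_inj).
apply: eq_bigr => i _; rewrite /=; congr (a _ ^+ _).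
by have := ltn_ord i; lia.
Qed.

Lemma residue_small (f : {poly CC}) : (size f < N)%N -> residue f = 0.
Proof.
move=> sf; apply: big1 => i _; have si := ltn_ord i.
have iN : (i.+1 < N)%N := leq_ltn_trans si sf.
have -> : i%:Z + (1 - N%:Z) = Negz (N - i).-2 by lia.
by rewrite mulr0.
Qed.

Lemma residue_monic (f : {poly CC}) : f \is monic -> size f = N -> residue f = 1.
Proof.
move=> mf sf; rewrite /residue /coefsum sf.
case: N sf => [|n] sf; first by move: (monic_neq0 mf); rewrite -size_poly_eq0 sf.
rewrite big_ord_recr /= big1 ?add0r => [|i _].
  rewrite (_ : n%:Z + _ = 0) ?mulr1; last by lia.
  by move/monicP: mf; rewrite lead_coefE sf.
have si : (i < n)%N := ltn_ord i.
have -> : i%:Z + (1 - n.+1%:Z) = Negz (n - i).-1 by lia.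
by rewrite mulr0.
Qed.

(** For a positive index [k = m - i + j], split off the last [j] factors of [A] as [B_j]; the first
    [N - j] join the [k - 1] factors of [h_k] to form [R_i]. For [k <= 0] the product has degree
    [N - 1 + k], so its residue is [1] or [0], as in the definition of [hka_ev]. *)
Lemma hka_ev_residue m i j : (i < N)%N -> (j < N)%N ->
  hka_ev (x_of a lam) (y_of a lam) (m%:Z - i.+1%:Z + j.+1%:Z)
    (shift (1 - j.+1%:Z) a) =
  residue (facpoly a (1 - N%:Z) (m + N - i.+1) * facpoly a (1 - j%:Z) j).
Proof.
move=> iN jN.
have sM : size (facpoly a (1 - N%:Z) (m + N - i.+1) * facpoly a (1 - j%:Z) j) =
    (m + N - i + j)%N.
  by rewrite size_monicM ?monic_facpoly ?monic_neq0 ?monic_facpoly //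
    !size_facpoly; lia.
have [mj|] := ltnP i (m + j)%N.
  have -> : m%:Z - i.+1%:Z + j.+1%:Z = (m + j - i).-1.+1 by lia.
  rewrite hka_ev_facpoly -residue_mul_facpoly.
  have -> : (m + N - i.+1 = (N - j) + (m + j - i).-1)%N by lia.
  have {2}-> : N = (N - j + j)%N by lia.
  rewrite !facpolyD (_ : 1 - N%:Z + (N - j)%N = 1 - j%:Z); last by lia.
  by rewrite mulrAC.
rewrite leq_eqVlt => /orP[/eqP mj|mj].
  have -> : m%:Z - i.+1%:Z + j.+1%:Z = 0 by lia.
  by rewrite residue_monic ?monicMl ?monic_facpoly // sM; lia.
have -> : m%:Z - i.+1%:Z + j.+1%:Z = Negz (i - (m + j)).-1 by lia.
by rewrite residue_small // sM; lia.
Qed.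

Lemma sma_ev_eq0 mu (r : 'I_(size mu)) : is_diagram mu -> (size mu <= N)%N ->
  (part r < nth 0 mu r)%N -> sma_ev mu a (x_of a lam) (y_of a lam) = 0.
Proof.
move=> muP muN lt_r; set n := size mu in r muN lt_r *.
pose R (i : 'I_n) := facpoly a (1 - N%:Z) (nth 0%N mu i + N - i.+1).
pose lin l : {poly CC} := 'X - (a ((part l)%:Z - l%:Z))%:P.
pose E := \prod_(l <- iota 0 r) lin l.
pose G := \prod_(l <- iota r (N - r)) lin l.
have rN : (r < N)%N := leq_trans (ltn_ord r) muN.
have DE : D = G * E.
  by rewrite /D big_map mulrC -big_cat -iotaD subnKC // ltnW.
have GR (i : 'I_n) : (i <= r)%N -> G %| R i.
  move=> ir; have mui : (nth 0 mu r <= nth 0 mu i)%N := part_anti muP ir.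
  (* [idx l] is the position of [a_{lam_l - l}] among the factors starting at [a_{1 - N}]. Comparing
     positions instead of values handles repeated values of [a]. *)
  pose idx l := (part l + N - l.+1)%N.
  have -> : G = \prod_(t <- [seq idx l | l <- iota r (N - r)])
                   ('X - (a (1 - N%:Z + t%:Z))%:P).
    rewrite big_map /G big_seq [RHS]big_seq; apply: eq_bigr => l.
    rewrite mem_iota subnKC ?(ltnW rN) // => /andP[_ lN].
    by rewrite /lin /idx; congr ('X - (a _)%:P); lia.
  apply: dvdp_prod_subset; last 1 first.
  (* For [i <= r <= l], [lam_l <= lam_r < mu_r <= mu_i] puts the position within the length of
     [R i]. *)
  - move=> t /mapP[l]; rewrite mem_iota subnKC ?(ltnW rN) // => /andP[rl lN] ->.
    by have := part_anti lamP rl; rewrite mem_iota /idx; lia.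
  - rewrite map_inj_in_uniq ?iota_uniq // => l1 l2.
    rewrite !mem_iota subnKC ?(ltnW rN) // => /andP[_ l1N] /andP[_ l2N].
    have [ll|/ltnW ll] := leqP l1 l2; have := part_anti lamP ll;
      by rewrite /idx; lia.
  - exact: iota_uniq.
have E0 : E != 0 by rewrite monic_neq0 // monic_prod_XsubC.
have [] := dvdp_lin_dep (r := r) E0 _ GR.
  by rewrite size_prod_XsubC size_iota.
move=> v v0; rewrite -DE => /dvdpP[q vR].
(* The same [v] kills every column: column [j] only multiplies the combination, a multiple of [D],
   by [B_j]. *)
apply/eqP/det0P; exists v => //; apply/rowP => j; rewrite !mxE.
transitivity (residue ((\sum_i v 0 i *: R i) * facpoly a (1 - j%:Z) j)).
  rewrite mulr_suml; under [X in residue X]eq_bigr do rewrite -scalerAl.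
  rewrite [RHS]coefsum_sum; apply: eq_bigr => i _; rewrite mxE.
  by rewrite hka_ev_residue // (leq_trans (ltn_ord _)).
by rewrite vR [q * D]mulrC -mulrA residue_mulD.
Qed.

End Vanishing.

Theorem theorem10 (a : int -> CC) (mu lam : seq nat) :
  is_diagram mu -> is_diagram lam -> ~ diag_sub mu lam ->
  sma_ev mu a (x_of a lam) (y_of a lam) = 0.
Proof.
move=> muP lamP nsub.
case: (boolP [exists r : 'I_(size mu), nth 0 lam r < nth 0 mu r]%N).
  case/existsP => r.
  (* Here [N] is the larger of the two lengths. *)
  exact: (sma_ev_eq0 a lamP (leq_maxr (size mu) (size lam))) (leq_maxl _ _).
move=> /existsPn le; case: nsub => i.
have [im|im] := ltnP i (size mu); last by rewrite nth_default.
by rewrite leqNgt; exact: le (Ordinal im).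
Qed.
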